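(* Let $n\in\mathbb{N}$ and let $V\subseteq\mathbb{R}^n$ be an affine coordinate subspace of dimension at least two. Then $V$ is of Khintchine type for divergence. That is, for every approximating function $\psi$ such that $\sum_{q=1}^{\infty}\psi(q)^n=\infty$, almost every point of $V$ (with respect to Lebesgue measure on $V$) is $\psi$-approximable.
   Context: For $\mathbf{x}\in\mathbb{R}^n$, $\|\mathbf{x}\|=\min_{\mathbf{z}\in\mathbb{Z}^n}\max_{1\le j\le n}|x_j-z_j|$ is the distance to the nearest integer point in the max-norm. An approximating function is a positive-valued decreasing (i.e. non-increasing) function $\psi$ defined on the positive reals (only its values on $\mathbb{N}$ matter). A point $\mathbf{x}\in\mathbb{R}^n$ is $\psi$-approximable if $\|q\mathbf{x}\|<\psi(q)$ for infinitely many $q\in\mathbb{N}$. An affine coordinate subspace of $\mathbb{R}^n$ of dimension $m$ is a set obtained by fixing $\ell$ of the $n$ coordinates to prescribed real values, where $\ell,m$ are positive integers with $\ell+m=n$, and leaving the remaining $m$ coordinates free; up to a permutation of coordinates it is of the form $\{\boldsymbol{\alpha}\}\times\mathbb{R}^m$ with $\boldsymbol{\alpha}\in\mathbb{R}^\ell$. *)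

(* Defs.v *)
From HB Require Import structures.
From mathcomp Require Import all_boot all_order all_algebra.
From mathcomp Require Import all_classical all_reals all_analysis.
From mathcomp Require Import lra.

Set Implicit Arguments.
Unset Strict Implicit.
Unset Printing Implicit Defensive.

Import Order.TTheory GRing.Theory Num.Theory.
Import numFieldNormedType.Exports.

Local Open Scope classical_set_scope.
Local Open Scope ring_scope.

(** The library has Lebesgue measure on R only. On R^n, represented by
    [n.-tuple R] with its product sigma-algebra, it is the iterated product:
    lambda_0 is the unit mass on the empty tuple, and lambda_(n+1) is the image
    of lambda_1 \x lambda_n under (x, t) |-> x :: t. *)

Section lebesgue_step.
Context (R : realType) (n : nat).
Local Notation T := (measurableTypeR R).

Definition tuple_cons (p : T * n.-tuple T) : n.+1.-tuple T :=
  [tuple of p.1 :: p.2].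

Lemma measurable_tuple_cons : measurable_fun [set: T * n.-tuple T] tuple_cons.
Proof. exact: (measurable_cons measurable_fst measurable_snd). Qed.

Variable mu : {sigma_finite_measure set (n.-tuple T) -> \bar R}.

Definition lebesgue_step : set (n.+1.-tuple T) -> \bar R :=
  pushforward (@lebesgue_measure R \x mu)%E tuple_cons.

Let step0 : lebesgue_step set0 = 0%E.
Proof. by rewrite /lebesgue_step /pushforward preimage_set0 measure0. Qed.

Let step_ge0 A : (0 <= lebesgue_step A)%E.
Proof. by rewrite /lebesgue_step /pushforward; exact: measure_ge0. Qed.

Let step_sigma_additive : semi_sigma_additive lebesgue_step.
Proof.
move=> F mF tF mUF; rewrite /lebesgue_step /pushforward preimage_bigcup.
apply: measure_semi_sigma_additive.
- by move=> k; rewrite -[X in measurable X]setTI; exact: measurable_tuple_cons.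
- apply/trivIsetP => /= i j _ _ ij; rewrite -preimage_setI.
  by move/trivIsetP : tF => /(_ _ _ _ _ ij) ->//; rewrite preimage_set0.
- by rewrite -preimage_bigcup -[X in measurable X]setTI;
    exact: measurable_tuple_cons.
Qed.

HB.instance Definition _ := isMeasure.Build _ _ _ lebesgue_step
  step0 step_ge0 step_sigma_additive.

Let step_sigma_finite : sigma_finite setT lebesgue_step.
Proof.
have /sigma_finiteP[F [TF ndF Foo]] := sigma_finiteT (@lebesgue_measure R).
have /sigma_finiteP[G [TG ndG Goo]] := sigma_finiteT mu.
pose h (t : n.+1.-tuple T) : T * n.-tuple T := (thead t, [tuple of behead t]).
have hK : cancel tuple_cons h.
  by case=> x t; rewrite /h theadE; congr pair; apply/val_inj.
have mh : measurable_fun setT h.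
  apply/measurable_fun_pairP; split => /=.
    exact: measurable_tnth.
  exact: measurable_behead.
exists (fun k => h @^-1` (F k `*` G k)).
  rewrite -preimage_bigcup -[LHS](preimage_setT h); congr (_ @^-1` _).
  rewrite -setXTT TF TG predeqE => -[x y]; split=> [[/= [i _ Fx] [k _ Gy]]|].
    exists (maxn i k) => //; split.
    - by move: x Fx; exact/subsetPset/ndF/leq_maxl.
    - by move: y Gy; exact/subsetPset/ndG/leq_maxr.
  by move=> [k _ [/= ? ?]]; split; exists k.
move=> k; have [mF Fk] := Foo k; have [mG Gk] := Goo k; split.
  by rewrite -[X in measurable X]setTI; apply: mh => //; exact: measurableX.
rewrite /lebesgue_step /pushforward -comp_preimage.
rewrite (_ : h \o tuple_cons = id); last by apply/funext => p; exact: hK.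
by rewrite preimage_id product_measure1E// lte_mul_pinfty// ge0_fin_numE.
Qed.

HB.instance Definition _ := Measure_isSigmaFinite.Build _ _ _ lebesgue_step
  step_sigma_finite.

End lebesgue_step.

Fixpoint lebesgue_tuple (R : realType) (n : nat) :
    {sigma_finite_measure set (n.-tuple (measurableTypeR R)) -> \bar R} :=
  match n with
  | 0 => \d_ [tuple]
  | n'.+1 => lebesgue_step (lebesgue_tuple R n')
  end.

Lemma lebesgue_tuple_box (R : realType) (n : nat)
    (A : 'I_n -> set (measurableTypeR R)) :
  (forall i, measurable (A i)) ->
  lebesgue_tuple R n [set t | forall i, A i (tnth t i)] =
  (\prod_(i < n) lebesgue_measure (A i))%E.
Proof.
elim: n A => [|n IH] A mA /=.
  by rewrite big_ord0 diracE mem_set // => -[].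
rewrite big_ord_recl -IH; last by move=> i; exact: mA.
rewrite -product_measure1E //; last first.
  rewrite (_ : [set _ | _] = \bigcap_(i in [set: 'I_n])
      ((fun t : n.-tuple (measurableTypeR R) => tnth t i) @^-1`
        A (lift ord0 i))); last first.
    apply/seteqP; split => t /= h i; [by move=> _; exact: h|exact: h].
  apply: fin_bigcap_measurable; first exact: finite_finset.
  move=> i _; rewrite -[X in measurable X]setTI.
  exact: measurable_tnth.
congr product_measure1; apply/seteqP; split => -[x t] /= h.
  by split => [|i]; [have := h ord0|have := h (lift ord0 i); rewrite tnthS].
move=> i; case: (unliftP ord0 i) => [j|] ->; last exact: h.1.
by rewrite tnthS; exact: h.2.
Qed.

Section approximation.
Context {R : realType}.

(** [`| x |] is the max-norm on row vectors ([mx_normrE]). *)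
Definition dist_int n (x : 'rV[R]_n) : R :=
  inf [set `|x - map_mx intr z| | z in [set: 'rV[int]_n]].

Lemma dist_int_min n (x : 'rV[R]_n) :
  exists2 z : 'rV[int]_n, dist_int x = `|x - map_mx intr z| &
    forall z' : 'rV[int]_n, `|x - map_mx intr z| <= `|x - map_mx intr z'|.
Proof.
pose z : 'rV[int]_n := \row_j Num.floor (x ord0 j + 2^-1).
have le_z (z' : 'rV[int]_n) : `|x - map_mx intr z| <= `|x - map_mx intr z'|.
  rewrite [leLHS]mx_normrE; apply/bigmax_leP; split => // -[i j] _ /=.
  rewrite [leRHS]mx_normrE; apply/bigmax_geP; right.
  exists (i, j) => //=; rewrite !mxE (ord1 i).
  have /andP[] := Num.Theory.floor_itv (x ord0 j + 2^-1).
  have [->//|ne] := eqVneq (z' ord0 j) (Num.floor (x ord0 j + 2^-1)).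
  move: ne; set k := Num.floor _; set k' := z' ord0 j => ne.
  rewrite intrD => lek ltk.
  apply: (@le_trans _ _ 2^-1).
    by rewrite ler_norml; apply/andP; split; lra.
  rewrite ler_normr; apply/orP.
  have [lt|] := ltP k k'.
    right; have : k%:~R + 1 <= k'%:~R :> R by rewrite -intrD1 ler_int lezD1.
    lra.
  rewrite le_eqVlt (negbTE ne) /= => lt.
  left; have : k'%:~R + 1 <= k%:~R :> R by rewrite -intrD1 ler_int lezD1.
  lra.
exists z => //; apply/eqP; rewrite eq_le; apply/andP; split.
  by apply: ge_inf; [exists 0 => _ [z' _ <-]|exists z].
by apply: lb_le_inf; [exists `|x - map_mx intr z|, z|move=> _ [z' _ <-]].
Qed.

(** The values of [psi] outside the positive reals are irrelevant. *)
Definition approximating_function (psi : R -> R) : Prop :=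
  (forall x, 0 < x -> 0 < psi x) /\
  (forall x y, 0 < x -> x <= y -> psi y <= psi x).

Definition psi_approximable n (psi : R -> R) (x : 'rV[R]_n) : Prop :=
  infinite_set [set q : nat | (0 < q)%N /\ dist_int (q%:R *: x) < psi q%:R].

End approximation.

Record affine_coordinate_subspace (R : realType) (n : nat) :=
  AffineCoordinateSubspace {
    fixed_coords : {set 'I_n};
    (* only the values at the fixed coordinates matter *)
    fixed_value : 'I_n -> R;
    fixed_coords_gt0 : (0 < #|fixed_coords|)%N;
    free_coords_gt0 : (0 < #|~: fixed_coords|)%N }.

Section subspace.
Context {R : realType} {n : nat} (V : affine_coordinate_subspace R n).

Definition subspace_set : set 'rV[R]_n :=
  [set x | forall i, i \in fixed_coords V -> x ord0 i = fixed_value V i].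

Definition subspace_dim : nat := #|~: fixed_coords V|.

(** The identification of R^m with V: [t] lists the free coordinates in
    increasing order of their indices. *)
Definition subspace_chart (t : subspace_dim.-tuple R) : 'rV[R]_n :=
  \row_i if i \in fixed_coords V then fixed_value V i
         else nth 0 t (index i (enum (~: fixed_coords V))).

Lemma range_subspace_chart : range subspace_chart = subspace_set.
Proof.
apply/seteqP; split => [_ [t _ <-] i iF|x xV]; first by rewrite mxE iF.
exists [tuple x ord0 (enum_val k) | k < subspace_dim] => //.
apply/rowP => i; rewrite mxE; case: ifPn => [/xV //|iF].
have ie : i \in enum (~: fixed_coords V) by rewrite mem_enum inE.
have lt_ie : (index i (enum (~: fixed_coords V)) < subspace_dim)%N.
  by rewrite /subspace_dim cardE index_mem.
rewrite -[index _ _]/(val (Ordinal lt_ie)) -tnth_nth tnth_mktuple.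
by congr (x _ _); rewrite (enum_val_nth i) nth_index.
Qed.

Lemma subspace_chart_inj : injective subspace_chart.
Proof.
move=> t u /rowP tu; apply/eq_from_tnth => k.
have := tu (enum_val k); have := enum_valP k; rewrite !mxE inE => /negbTE ->.
rewrite (enum_val_nth (enum_val k)) index_uniq ?enum_uniq //.
  by rewrite -!tnth_nth.
by rewrite -cardE.
Qed.

(** Lebesgue measure on V is transported from R^m by the chart. *)
Definition ae_subspace (P : 'rV[R]_n -> Prop) : Prop :=
  {ae lebesgue_tuple R subspace_dim, forall t, P (subspace_chart t)}.

Definition khintchine_type_divergence : Prop :=
  forall psi : R -> R, approximating_function psi ->
  (\sum_(1 <= q <oo) (psi q%:R ^+ n)%:E = +oo)%E ->
  ae_subspace (psi_approximable psi).

End subspace.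

(* Main.v *)
(** By Fubini it suffices to let two coordinates vary, all the others being
    fixed to a tuple [al]. For [h = min (psi, 1/9) / (p + 1)], Dirichlet's
    pigeonhole argument bounds from below the number of [q < t] with
    [|q al| < h q], and summation by parts turns the divergence of
    [sum h(q)^n] into that of [sum h(q)^2] over these good [q]. As in
    Gallagher's theorem, the squares of side [h(q) / q] at the points
    [(a / q, b / q)] with [gcd (a, b, q) = 1] form sets that are pairwise
    quasi-independent for distinct [q], whatever the set of good [q]; that
    dimension two suffices is due to the convergence of [sum 1 / l^2]. Hence for
    every [p] the points [x] with [|q (al, x)| < psi(q) / (p + 1)] for some
    good [q > p] fill at least 1/576 of the unit square. The bound does not
    depend on [p], so it persists for the intersection over [p], which is
    invariant under integer translations and maps [x |-> k x] in each coordinate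
    and therefore conull by a zero-one law. *)

Require Import Defs.
From mathcomp Require Import all_boot all_order all_algebra.
From mathcomp Require Import all_classical all_reals all_analysis.
From mathcomp Require Import measurable_realfun.
From mathcomp Require Import lra ring zify.

Set Implicit Arguments.
Unset Strict Implicit.
Unset Printing Implicit Defensive.

Import Order.TTheory GRing.Theory Num.Theory.
Import numFieldNormedType.Exports.

Local Open Scope classical_set_scope.
Local Open Scope ring_scope.

(** * Dirichlet's pigeonhole argument and summation by parts *)

Section counting.
Context {R : realType}.
Implicit Types (c r : R) (al : seq R) (h : nat -> R).

Definition near_int c r := exists z : int, `|r - z%:~R| < c.

Lemma near_intW c c' r : c <= c' -> near_int c r -> near_int c' r.
Proof. by move=> cc' [z zc]; exists z; exact: lt_le_trans cc'. Qed.

Lemma near_int_natM (K : nat) c r :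
  (0 < K)%N -> near_int c r -> near_int (K%:R * c) (K%:R * r).
Proof.
move=> K0 [z zc]; exists (K%:Z * z); rewrite intrM -pmulrn -mulrBr normrM.
by rewrite normr_nat ltr_pM2l ?ltr0n.
Qed.

Lemma near_intD (z : int) c r : near_int c r -> near_int c (r + z%:~R).
Proof.
by move=> [w wc]; exists (w + z); rewrite intrD opprD addrACA subrr addr0.
Qed.

(** Otherwise [M] times each fibre, plus 1, is at most [#|S|]; summing over the [M] fibres gives
    [M * #|S| + M <= M * #|S|]. *)
Lemma pigeonhole_fiber (t M : nat) (S : {set 'I_t}) (g : 'I_t -> 'I_M) :
  (0 < M)%N -> exists j, (#|S| <= M * #|[set q in S | g q == j]|)%N.
Proof.
move=> M0; apply/not_existsP => /= nex.
have lt j : (M * #|[set q in S | g q == j]| < #|S|)%N.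
  by rewrite ltnNge; apply/negP => /nex.
have : (\sum_(j < M) (M * #|[set q in S | g q == j]|).+1 <= \sum_(j < M) #|S|)%N.
  by apply: leq_sum => j _; exact: lt.
rewrite sum_nat_const card_ord.
under eq_bigr do rewrite -addn1.
rewrite big_split /= sum1_card card_ord -big_distrr /=.
suff : (\sum_(j < M) #|[set q in S | g q == j]| = #|S|)%N.
  by move=> ->; rewrite -[leqRHS]addn0 leq_add2l leqNgt M0.
rewrite -sum1_card (partition_big g predT) //=; apply: eq_bigr => j _.
by rewrite -sum1_card; apply: eq_bigl => q; rewrite inE.
Qed.

(** For each [a] in turn, only those [q] are kept for which the fractional part of [q a] lies in one
    well-filled part among [M] equal parts of [[0, 1)]. This costs at most a factor [M]. *)
Lemma bohr_set al (t M : nat) : (0 < M)%N ->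
  exists2 S : {set 'I_t}, (t <= M ^ size al * #|S|)%N &
    {in S &, forall q q' : 'I_t, forall a, a \in al ->
      near_int M%:R^-1 (q%:R * a - q'%:R * a)}.
Proof.
move=> M0; elim: al => [|a al [S tS nS]].
  by exists [set: 'I_t]%SET => //; rewrite cardsT card_ord mul1n.
pose fr (r : R) := r - (Num.floor r)%:~R.
have fr0 r : 0 <= fr r < 1.
  have /andP[] := Num.Theory.floor_itv r; rewrite intrD => ? ?.
  by apply/andP; rewrite /fr; split; lra.
have M0' : 0 < M%:R :> R by rewrite ltr0n.
have tM (q : 'I_t) : (Num.truncn (M%:R * fr (q%:R * a))%R < M)%N.
  have /andP[f0 f1] := fr0 (q%:R * a).
  have := truncn_le (M%:R * fr (q%:R * a)); rewrite mulr_ge0 ?ler0n // => h.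
  by rewrite -(ltr_nat R); apply: (le_lt_trans h); rewrite gtr_pMr.
have [j Sj] := pigeonhole_fiber S (fun q => Ordinal (tM q)) M0.
exists [set q in S | Ordinal (tM q) == j]%SET.
  rewrite expnS -mulnA mulnCA; apply: (leq_trans tS); rewrite leq_pmul2l //.
  by rewrite expn_gt0 M0.
move=> q q'; rewrite !inE => /andP[qS /eqP qj] /andP[q'S /eqP q'j] b.
rewrite inE => /predU1P[->|]; last exact: nS.
exists (Num.floor (q%:R * a) - Num.floor (q'%:R * a)); rewrite intrB.
have -> : q%:R * a - q'%:R * a - ((Num.floor (q%:R * a))%:~R -
  (Num.floor (q'%:R * a))%:~R) = fr (q%:R * a) - fr (q'%:R * a).
  by rewrite /fr; ring.
have E (p : 'I_t) : Ordinal (tM p) = j ->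
    j%:R <= M%:R * fr (p%:R * a) < j%:R + 1.
  move=> <- /=; have /andP[f0 _] := fr0 (p%:R * a).
  have := @truncn_itv R (M%:R * fr (p%:R * a)).
  by rewrite mulr_ge0 ?ler0n // -natr1; exact.
have := E _ qj; have := E _ q'j => /andP[? ?] /andP[? ?].
rewrite -(ltr_pM2l M0') divff ?gt_eqF // -[X in X * `|_|]gtr0_norm //.
by rewrite -normrM mulrBr ltr_norml; apply/andP; split; lra.
Qed.

(** The elements of the set from [bohr_set], diminished by its least element, are distinct good
    [q < t]. The index [q = 0] is counted too. *)
Lemma near_int_count al (t M : nat) : (0 < M)%N ->
  (t <= M ^ size al *
     \sum_(0 <= q < t) `[< forall a, a \in al -> near_int M%:R^-1 (q%:R * a) >])%N.
Proof.
move=> M0; have [S tS nS] := bohr_set al t M0.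
apply: (leq_trans tS); rewrite leq_mul2l; apply/orP; right.
have [->|[q0 q0S]] := set_0Vmem S; first by rewrite cards0.
have [m mS mmin] := @arg_minnP _ q0 (mem S) (@nat_of_ord t) q0S.
pose P (q : 'I_t) := `[< forall a, a \in al -> near_int M%:R^-1 (q%:R * a) >].
rewrite big_mkord -big_mkcond /= sum1_card.
have lt (q : 'I_t) : (q - m < t)%N by rewrite (leq_ltn_trans (leq_subr _ _)).
rewrite -(@card_in_imset _ _ (fun q => Ordinal (lt q)) (mem S)); last first.
  move=> q q' qS q'S [] e; apply/val_inj => /=.
  by rewrite -(subnK (mmin _ qS)) e subnK // mmin.
apply/subset_leq_card/fintype.subsetP => _ /imsetP[q qS ->].
rewrite unfold_in; apply/asboolP => a aal /=.
by rewrite natrB ?mmin // mulrBl; exact: nS.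
Qed.

(** The difference is [x - y] times a sum of [l + 2] monomials, each at most [x ^ (l + 1)]; moreover
    [x (x - y) <= x ^ 2 - y ^ 2]. *)
Lemma subrXX_le (l : nat) (x y : R) : 0 <= y -> y <= x ->
  x ^+ l.+2 - y ^+ l.+2 <= l.+2%:R * (x ^+ l * (x ^+ 2 - y ^+ 2)).
Proof.
move=> y0 yx; have x0 := le_trans y0 yx.
apply: (@le_trans _ _ (l.+2%:R * (x ^+ l.+1 * (x - y)))).
  rewrite subrXX mulrC mulrA ler_wpM2r ?subr_ge0 //.
  rewrite -[l.+2 in leRHS]card_ord -sum1_card natr_sum mulr_suml ler_sum // => i _.
  have il : (i <= l.+1)%N by rewrite -ltnS.
  rewrite mul1r -[in leRHS](subnK il) exprD.
  by rewrite ler_wpM2l ?exprn_ge0 // lerXn2r ?nnegrE.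
rewrite ler_wpM2l // exprSr -mulrA ler_wpM2l ?exprn_ge0 //.
by rewrite subr_sqr mulrC ler_wpM2l ?subr_ge0 // lerDl.
Qed.

(* Summation by parts; the power of [h] is split off by
   [subrXX_le]. *)
Lemma abel_lower h (w : nat -> R) c (l : nat) (T : nat) :
    0 <= c -> (forall q, 0 <= w q) -> (forall q, (0 < q)%N -> 0 <= h q) ->
    (forall q, (0 < q)%N -> h q.+1 <= h q) ->
    (forall t, (0 < t)%N -> c * t%:R * h t ^+ l <= 1 + \sum_(1 <= q < t) w q) ->
  (0 < T)%N ->
  c / l.+2%:R * \sum_(1 <= q < T) h q ^+ l.+2 <=
    \sum_(1 <= q < T) w q * h q ^+ 2 + h 1%N ^+ 2.
Proof.
move=> c0 w0 h0 hS cN T0.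
pose N t := 1 + \sum_(1 <= q < t) w q.
(* The boundary terms at [T] carry the induction, and [cN] at [T] compares them. For [T = 1] both
   sides vanish: [h 1 ^+ 2] cancels the summand 1 of [N]. *)
suff : c / l.+2%:R * (\sum_(1 <= q < T) h q ^+ l.+2 - T.-1%:R * h T ^+ l.+2) <=
    \sum_(1 <= q < T) w q * h q ^+ 2 + h 1%N ^+ 2 - N T * h T ^+ 2.
  have : c / l.+2%:R * (T.-1%:R * h T ^+ l.+2) <= N T * h T ^+ 2.
    have := cN T T0; rewrite -/(N T) => /(ler_wpM2r (sqr_ge0 (h T))).
    apply: le_trans; rewrite -(addn2 l) exprD addn2 !mulrA.
    rewrite 2?ler_wpM2r ?h0 // ler_wpM2r ?exprn_ge0 ?h0 //.
    rewrite ler_pM ?ler_nat ?leq_pred // ?mulr_ge0 // ?invr_ge0 //.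
    by rewrite ler_piMr // invf_le1 // ler1n.
  rewrite mulrBr; move: (c / _ * (_ * _)) (c / _ * \sum_(_ <= _ < _) _) => x y.
  by move: (N T * _) (\sum_(_ <= _ < _) _) (h 1%N ^+ 2) => u v z; lra.
elim: T T0 => // -[|T] IH _.
  by rewrite !big_geq // /N big_geq // mul0r subr0 mulr0 addr0 mul1r add0r subrr.
have {}IH := IH isT.
rewrite big_nat_recr //= [X in _ <= X + _ - _]big_nat_recr //=.
have NS : N T.+2 = N T.+1 + w T.+1 by rewrite /N big_nat_recr //= addrA.
suff : c / l.+2%:R * (T.+1%:R * (h T.+1 ^+ l.+2 - h T.+2 ^+ l.+2)) <=
       N T.+2 * (h T.+1 ^+ 2 - h T.+2 ^+ 2).
  rewrite NS; move: IH => /=; move: (N _) => n.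
  move: (\sum_(_ <= _ < _) _) => x; move: (\sum_(_ <= _ < _) _) => y.
  rewrite -[T.+1%:R]natr1; move: (c / _) => k.
  by move: (h T.+1 ^+ _) (h T.+2 ^+ _) => u v; lra.
have hT1 := h0 T.+1 isT; have hT2 := h0 T.+2 isT.
have hT := hS T.+1 isT.
have a_ge0 : 0 <= h T.+1 ^+ 2 - h T.+2 ^+ 2 by rewrite subr_ge0 lerXn2r ?nnegrE.
apply: (@le_trans _ _ (c * T.+1%:R * h T.+1 ^+ l * (h T.+1 ^+ 2 - h T.+2 ^+ 2))).
  have := ler_wpM2l (mulr_ge0 c0 (ler0n R T.+1)) (subrXX_le l hT2 hT).
  have n0 : l.+2%:R != 0 :> R by rewrite pnatr_eq0.
  rewrite -(ler_pM2l (x := l.+2%:R^-1)) ?invr_gt0 ?ltr0n // => /le_trans.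
  rewrite (_ : c / _ * _ = l.+2%:R^-1 *
    (c * T.+1%:R * (h T.+1 ^+ l.+2 - h T.+2 ^+ l.+2))); last by ring.
  by apply; rewrite mulrCA mulKf // -!mulrA.
rewrite ler_wpM2r // (le_trans (cN _ _)) // -/(N _) NS lerDl; exact: w0.
Qed.

End counting.

(** * Counting primitive pairs and nearly equal fractions *)

Section arith.
Context {R : realType}.

(** From [l = 3] on, [1 / l ^ 2 <= 1 / (l - 1) - 1 / l] telescopes to at most 1/2, and [l = 2] adds
    1/4. A bound below 1 is what leaves a positive proportion of primitive pairs. *)
Lemma sum_inv_sqr_le (q : nat) :
  \sum_(2 <= l < q.+1) (l%:R ^+ 2)^-1 <= 3 / 4 :> R.
Proof.
case: q => [|[|q]]; [by rewrite big_geq //; lra|by rewrite big_geq //; lra|].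
suff : \sum_(2 <= l < q.+3) (l%:R ^+ 2)^-1 <= 3 / 4 - q.+2%:R^-1 :> R.
  by move=> /le_trans; apply; rewrite gerBl invr_ge0.
elim: q => [|q IH]; first by rewrite big_nat1; lra.
rewrite big_nat_recr //=; move: IH; move: (\sum_(_ <= _ < _) _) => s.
have : (q.+3%:R ^+ 2)^-1 <= q.+2%:R^-1 - q.+3%:R^-1 :> R.
  have q0 : 0 < q.+2%:R :> R by rewrite ltr0n.
  rewrite -[q.+3%:R]natr1; move: q0; move: (q.+2%:R : R) => x x0.
  have x1 : x + 1 != 0 by rewrite gt_eqF // addr_gt0.
  have x2 : x != 0 by rewrite gt_eqF.
  have -> : x^-1 - (x + 1)^-1 = (x * (x + 1))^-1 by field; apply/andP.
  by rewrite lef_pV2 ?posrE ?expr2 ?mulr_gt0 ?addr_gt0 // ler_pM2r ?addr_gt0 // lerDl.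
move: (q.+3%:R^-1 : R) (q.+2%:R^-1 : R) => u v.
by move: (_ ^-1) => w; lra.
Qed.

Definition primitive_pairs (q : nat) : {set 'I_q * 'I_q} :=
  [set p : 'I_q * 'I_q | gcdn (gcdn p.1 p.2) q == 1%N]%SET.

(** A pair that is not primitive has both entries divisible by some divisor [l > 1] of [q], and at
    most [(q / l) ^ 2] pairs have this property for a given [l]. *)
Lemma card_primitive_pair (q : nat) : (0 < q)%N ->
  q%:R ^+ 2 / 4 <= #|primitive_pairs q|%:R :> R.
Proof.
move=> q0.
pose D l : {set 'I_q} := [set a : 'I_q | (l %| a)%N]%SET.
have cardD l : (l %| q)%N -> (0 < l)%N -> (#|D l| <= q %/ l)%N.
  move=> lq l0; have ql : (0 < q %/ l)%N by rewrite divn_gt0 // dvdn_leq.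
  have lt (a : 'I_q) : (a %/ l < q %/ l)%N.
    by rewrite ltn_divLR // divnK.
  rewrite -(@card_in_imset _ _ (fun a => Ordinal (lt a))).
    by rewrite -[leqRHS]card_ord max_card.
  move=> a b; rewrite !inE => la lb [] e; apply/val_inj.
  by rewrite /= -(divnK la) e divnK.
have nonprim : (#|~: primitive_pairs q| <=
    \sum_(l < q.+1 | (1 < l) && (l %| q)) #|finset.setX (D l) (D l)|)%N.
  apply: (@leq_trans #|\bigcup_(l < q.+1 | (1 < l)%N && (l %| q)%N)
      finset.setX (D l) (D l)|); last first.
    elim/big_rec2: _ => [|l m A _ IH]; first by rewrite cards0.
    by rewrite (leq_trans (leq_card_setU _ _)) // leq_add2l.
  apply/subset_leq_card/fintype.subsetP => -[a b]; rewrite !inE => /= np.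
  have g0 : (0 < gcdn (gcdn a b) q)%N by rewrite gcdn_gt0 q0 orbT.
  have gq : (gcdn (gcdn a b) q < q.+1)%N by rewrite ltnS dvdn_leq // dvdn_gcdr.
  apply/bigcupP; exists (Ordinal gq) => /=.
    by rewrite dvdn_gcdr andbT; move: np g0; case: gcdn => [|[]].
  rewrite !inE /=; apply/andP; split; apply: dvdn_trans (dvdn_gcdl _ _) _.
    exact: dvdn_gcdl.
  exact: dvdn_gcdr.
have total : (#|primitive_pairs q| +
    #|~: primitive_pairs q| = q ^ 2)%N.
  have <- : #|[set: 'I_q * 'I_q]%SET| = (q ^ 2)%N.
    by rewrite cardsT card_prod card_ord mulnn.
  rewrite -(cardsID (primitive_pairs q) [set: _]%SET).
  by rewrite finset.setTI finset.setTD.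
have : #|~: primitive_pairs q|%:R <= q%:R ^+ 2 * (3 / 4) :> R.
  apply: (@le_trans _ _ (\sum_(l < q.+1 | (1 < l)%N && (l %| q)%N)
      q%:R ^+ 2 * (l%:R ^+ 2)^-1)).
    apply: (@le_trans _ _ (\sum_(l < q.+1 | (1 < l)%N && (l %| q)%N)
      #|finset.setX (D l) (D l)|%:R)); first by rewrite -natr_sum ler_nat.
    apply: ler_sum => l /andP[l1 lq]; have l0 : (0 < l)%N by apply: ltn_trans l1.
    rewrite cardsX natrM -expr2 -exprVn -exprMn lerXn2r ?nnegrE ?divr_ge0 //.
    by rewrite ler_pdivlMr ?ltr0n // -natrM ler_nat -leq_divRL // cardD.
  rewrite -mulr_sumr ler_wpM2l ?sqr_ge0 // (le_trans _ (sum_inv_sqr_le q)) //.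
  rewrite [leRHS]big_nat_cond -(big_mkord (fun l => (1 < l)%N && (l %| q)%N)
    (fun l => (l%:R ^+ 2)^-1)) /=.
  rewrite big_mkcond [leRHS]big_mkcond /=.
  case: q {q0 D cardD nonprim total} => [|q].
    by rewrite big_nat1 big_geq.
  rewrite big_ltn // big_ltn //= !add0r.
  apply: ler_sum_nat => l /andP[l1 lq]; rewrite l1 lq /=.
  by case: ifP => // _; rewrite invr_ge0 sqr_ge0.
move=> h; have := congr1 (fun n => n%:R : R) total.
rewrite natrD natrX; lra.
Qed.

(* A value of [a r - b q] is a multiple of [d = gcd q r], and determines [a]
   modulo [q / d] as well as [b] in terms of [a]. *)
Lemma card_close_fractions (q r : nat) (X : R) :
  (0 < q)%N -> (0 < r)%N -> (gcdn q r)%:R <= X ->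
  #|[set p : 'I_q * 'I_r | `|p.1%:R * r%:R - p.2%:R * q%:R| < X]%SET|%:R <= 3 * X.
Proof.
move=> q0 r0; set d := gcdn q r => dX.
have d0 : (0 < d)%N by rewrite gcdn_gt0 q0.
pose K := Num.truncn (X / d%:R).
pose q' := (q %/ d)%N; pose r' := (r %/ d)%N.
have qE : q = (q' * d)%N by rewrite divnK // dvdn_gcdl.
have rE : r = (r' * d)%N by rewrite divnK // dvdn_gcdr.
have q'0 : (0 < q')%N by rewrite divn_gt0 // dvdn_leq // dvdn_gcdl.
have r'0 : (0 < r')%N by rewrite divn_gt0 // dvdn_leq // dvdn_gcdr.
have cop : coprime q' r'.
  rewrite /coprime -(eqn_pmul2r d0) muln_gcdl.
  by rewrite -qE -rE mul1n eqxx.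
have d0' : 0 < d%:R :> R by rewrite ltr0n.
have XK : X < K.+1%:R * d%:R.
  by rewrite -ltr_pdivrMr //; have := @truncnS_gt R (X / d%:R).
have KX : K%:R * d%:R <= X.
  by rewrite -ler_pdivlMr // truncn_le divr_ge0 // (le_trans _ dX).
clearbody K q' r' d.
set S := finset _.
have SK p : p \in S -> (p.1 * r' <= p.2 * q' + K)%N /\ (p.2 * q' <= p.1 * r' + K)%N.
  have qR : q%:R = q'%:R * d%:R :> R by rewrite -natrM -qE.
  have rR : r%:R = r'%:R * d%:R :> R by rewrite -natrM -rE.
  rewrite inE qR rR !mulrA -mulrBl normrM (gtr0_norm d0') => h.
  have : `|p.1%:R * r'%:R - p.2%:R * q'%:R| < K.+1%:R :> R.
    by rewrite -(ltr_pM2r d0') (lt_trans h).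
  rewrite ltr_norml -natr1 => /andP[h1 h2].
  split; rewrite -ltnS -(ltr_nat R) -natr1 natrD !natrM; lra.
(* The differences [a r' - b q'] lie in [[-K, K]]; the shift by [K] makes them natural numbers. The
   quotient of [a] by [q'] takes at most [d] values and recovers [a] from its residue. *)
pose f (p : 'I_q * 'I_r) : 'I_(K + K).+1 * 'I_d.-1.+1 :=
  (inord (p.1 * r' + K - p.2 * q'), inord (p.1 %/ q')).
have ltd (p : 'I_q * 'I_r) : (p.1 %/ q' < d)%N.
  by rewrite ltn_divLR // mulnC -qE.
(* Equality of differences is written additively, since subtraction on [nat] truncates. *)
have modeq (a b a2 b2 : nat) :
    (a * r' + b2 * q' = a2 * r' + b * q')%N -> (a = a2 %[mod q'])%N.
  wlog le : a b a2 b2 / (a2 <= a)%N => [hw|e].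
    by case: (leqP a2 a) => [/hw|/ltnW /hw le e]; [exact|apply/esym/le/esym/e].
  apply/eqP; rewrite eqn_mod_dvd // -(Gauss_dvdl _ cop) mulnBl.
  have -> : (a * r' - a2 * r' = (b - b2) * q')%N by rewrite mulnBl; lia.
  exact: dvdn_mull.
have finj : {in S &, injective f}.
  move=> p p2 /[dup] pS /SK[h1 h2] /[dup] p2S /SK[h3 h4] [].
  have bnd (x y : nat) : (x <= y + K)%N -> (x + K - y <= K + K)%N by lia.
  have can (x y x2 y2 : nat) : (y <= x + K)%N -> (y2 <= x2 + K)%N ->
    (x + K - y = x2 + K - y2)%N -> (x + y2 = x2 + y)%N by lia.
  move=> /(congr1 val) /=; rewrite !inordK ?ltnS ?bnd //.
  move=> e1 /(congr1 val) /=; rewrite !inordK ?prednK //.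
  move=> e2.
  have ea := can _ _ _ _ h2 h4 e1.
  have ma : (p.1 = p2.1 %[mod q'])%N.
    by apply: modeq ea.
  have pa : p.1 = p2.1.
    by apply/val_inj; rewrite /= (divn_eq p.1 q') (divn_eq p2.1 q') e2 ma.
  have pb : p.2 = p2.2.
    apply/val_inj/eqP; rewrite /= -(eqn_pmul2r q'0); apply/eqP.
    by move: ea; rewrite pa => /addnI.
  by case: p p2 pa pb {pS h1 h2 p2S h3 h4 e1 e2 ea ma} => ? ? [? ?] /= -> ->.
have : (#|S| <= (K + K).+1 * d)%N.
  rewrite -(card_in_imset finj) (leq_trans (max_card _)) //.
  by rewrite card_prod !card_ord prednK.
(* [(2 K + 1) d <= 3 X] follows from [K d <= X] and [d <= X]. *)
rewrite -(ler_nat R) => /le_trans; apply.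
rewrite natrM -natr1 natrD.
by rewrite !mulrDl mul1r; lra.
Qed.

End arith.

(** * Measures of finite unions *)

Section finite_pieces.
Context d (T : measurableType d) (R : realType) (mu : {measure set T -> \bar R}).
Context (I : finType) (S : {set I}) (F : I -> set T) (c : R).
Hypothesis mF : forall i, measurable (F i).

Lemma measure_equal_pieces : (forall i, i \in S -> mu (F i) = c%:E) ->
  trivIset [set` S] F ->
  mu (\bigcup_(i in [set` S]) F i) = (c *+ #|S|)%:E.
Proof.
move=> muF tF; rewrite measure_fin_bigcup //.
rewrite (_ : [set` S] = [set` enum S]); last first.
  by apply/seteqP; split => i /=; rewrite mem_enum.
rewrite -fsbig_seq ?enum_uniq // big_enum /=.
by rewrite (eq_bigr _ muF) sumEFin sumr_const.
Qed.

Lemma measure_subset_pieces (A : set T) : measurable A ->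
  A `<=` \bigcup_(i in [set` S]) F i ->
  (forall i, i \in S -> (mu (F i) <= c%:E)%E) -> (mu A <= (c *+ #|S|)%:E)%E.
Proof.
move=> mA AF muF; rewrite (le_trans (content_sub_fsum mu _ _ _ AF)) //.
rewrite (_ : [set` S] = [set` enum S]); last first.
  by apply/seteqP; split => i /=; rewrite mem_enum.
rewrite -fsbig_seq ?enum_uniq // big_enum /=.
by rewrite (le_trans (lee_sum _ muF)) // sumEFin sumr_const.
Qed.

End finite_pieces.

(** * Squares at primitive rational points and their overlaps *)

Section rational_boxes.
Context {R : realType}.
Local Notation T := (measurableTypeR R).
Local Notation mu := (@lebesgue_measure R).
Local Notation mu2 := (mu \x mu)%E.

(* One-sided neighbourhoods of [a / q] keep everything inside [[0, 1)]. *)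
Definition frac_itv (e : R) (q : nat) (a : 'I_q) : set T :=
  [set` `[a%:R / q%:R, a%:R / q%:R + e / q%:R[ ].

Definition frac_set (e : R) (q : nat) : set T :=
  \bigcup_(a in [set: 'I_q]) frac_itv e a.

Definition prim_set (e : R) (q : nat) : set (T * T) :=
  \bigcup_(p in [set` primitive_pairs q])
    (frac_itv e p.1 `*` frac_itv e p.2).

Lemma measurable_frac_itv e q (a : 'I_q) : measurable (frac_itv e a).
Proof. exact: measurable_itv. Qed.

Lemma measurable_frac_set e q : measurable (frac_set e q).
Proof.
apply: fin_bigcup_measurable => [|a _]; first exact: finite_finset.
exact: measurable_frac_itv.
Qed.

Lemma measurable_prim_set e q : measurable (prim_set e q).
Proof.
apply: fin_bigcup_measurable => [|p _]; first exact: finite_finset.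
by apply: measurableX; exact: measurable_frac_itv.
Qed.

Lemma lebesgue_frac_itv e q (a : 'I_q) : 0 <= e ->
  mu (frac_itv e a) = (e / q%:R)%:E.
Proof.
rewrite le_eqVlt => /predU1P[<-|e0].
  by rewrite /frac_itv mul0r addr0 set_itvco0 measure0.
have q0 : 0 < q%:R :> R by rewrite ltr0n (leq_ltn_trans _ (ltn_ord a)).
rewrite lebesgue_measure_itv /= lte_fin ltrDl divr_gt0 // -EFinB.
by rewrite addrAC subrr add0r.
Qed.

Lemma frac_itvP e q (a : 'I_q) (x : R) : frac_itv e a x ->
  a%:R <= q%:R * x < a%:R + e.
Proof.
have q0 : 0 < q%:R :> R by rewrite ltr0n (leq_ltn_trans _ (ltn_ord a)).
rewrite /frac_itv /= in_itv /= -mulrDl ler_pdivrMr // ltr_pdivlMr //.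
by rewrite mulrC.
Qed.

Lemma frac_itv_inj e q (a b : 'I_q) (x : R) : e <= 1 ->
  frac_itv e a x -> frac_itv e b x -> a = b.
Proof.
move=> e1 /frac_itvP/andP[a1 a2] /frac_itvP/andP[b1 b2].
have ab : (a < b.+1)%N by rewrite -(ltr_nat R) -natr1; lra.
have ba : (b < a.+1)%N by rewrite -(ltr_nat R) -natr1; lra.
by apply/val_inj/eqP; rewrite eqn_leq; apply/andP; split; rewrite -ltnS.
Qed.

(** Both [a r] and [b q] are at most [q r x], within [e r] and [e' q] respectively. One-sidedness
    yields the maximum of the two widths instead of their sum. *)
Lemma frac_itv_close e e' q r (a : 'I_q) (b : 'I_r) (x : R) :
  frac_itv e a x -> frac_itv e' b x ->
  `|a%:R * r%:R - b%:R * q%:R| < Num.max (e * r%:R) (e' * q%:R).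
Proof.
have q0 : 0 < q%:R :> R by rewrite ltr0n (leq_ltn_trans _ (ltn_ord a)).
have r0 : 0 < r%:R :> R by rewrite ltr0n (leq_ltn_trans _ (ltn_ord b)).
move=> /frac_itvP/andP[]; rewrite -(ler_pM2r r0) -(ltr_pM2r r0) => a1 a2.
move=> /frac_itvP/andP[]; rewrite -(ler_pM2r q0) -(ltr_pM2r q0) => b1 b2.
rewrite lt_max !ltr_norml.
have [le|lt] := leP (b%:R * q%:R : R) (a%:R * r%:R); apply/orP.
  by right; apply/andP; split; lra.
by left; apply/andP; split; lra.
Qed.

(** With [X = max (e r, e' q)], at most [3 X] pairs of intervals meet, each in measure at most
    [min (e / q, e' / r)], and [X] times this minimum is at most [e e']. *)
Lemma lebesgue_frac_setI e e' q r : (0 < q)%N -> (0 < r)%N ->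
    0 <= e -> 0 <= e' ->
    (gcdn q r)%:R <= Num.max (e * r%:R) (e' * q%:R) ->
  (mu (frac_set e q `&` frac_set e' r) <= (3 * (e * e'))%:E)%E.
Proof.
move=> q0 r0 e0 e'0 gX; have := card_close_fractions q0 r0 gX.
set X := Num.max _ _ in gX *; set S := finset _ => cS.
pose F (p : 'I_q * 'I_r) := frac_itv e p.1 `&` frac_itv e' p.2.
have mF p : measurable (F p) by apply: measurableI; exact: measurable_frac_itv.
have sF : frac_set e q `&` frac_set e' r `<=` \bigcup_(p in [set` S]) F p.
  move=> x [[a _ xa] [b _ xb]]; exists (a, b) => //=.
  by rewrite inE /=; exact: frac_itv_close xa xb.
have := @measure_subset_pieces _ _ _ mu _ S F (Num.min (e / q%:R) (e' / r%:R)) mF _ _ sF.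
have q0' : 0 < q%:R :> R by rewrite ltr0n.
have r0' : 0 < r%:R :> R by rewrite ltr0n.
move=> /(_ _ _)/le_trans; apply.
- by apply: measurableI; exact: measurable_frac_set.
- move=> p _; rewrite EFin_min le_min; apply/andP; split.
    by rewrite -(lebesgue_frac_itv p.1 e0) measureIl //; exact: measurable_frac_itv.
  by rewrite -(lebesgue_frac_itv p.2 e'0) measureIr //; exact: measurable_frac_itv.
rewrite lee_fin -[leLHS]mulr_natl.
apply: (@le_trans _ _ (3 * X * Num.min (e / q%:R) (e' / r%:R))).
  by rewrite ler_wpM2r // le_min !divr_ge0.
rewrite -mulrA ler_wpM2l // /X.
have [le|lt] := leP (e * r%:R) (e' * q%:R).
  rewrite (mulrC e e') -mulrA ler_wpM2l // mulrC -ler_pdivlMr //.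
  by rewrite ge_min lexx.
rewrite -mulrA ler_wpM2l // mulrC -ler_pdivlMr //.
by rewrite ge_min lexx orbT.
Qed.

(** For [e <= 1] the squares are disjoint, each of area [(e / q) ^ 2], and their number is between
    [q ^ 2 / 4] and [q ^ 2]. *)
Lemma lebesgue_prim_set e q : (0 < q)%N -> 0 <= e <= 1 ->
  ((e ^+ 2 / 4)%:E <= mu2 (prim_set e q) <= (e ^+ 2)%:E)%E.
Proof.
move=> q0 /andP[e0 e1].
have q0' : 0 < q%:R :> R by rewrite ltr0n.
rewrite /prim_set (measure_equal_pieces (c := (e / q%:R) ^+ 2)).
- rewrite !lee_fin; apply/andP; split.
    rewrite -[leRHS]mulr_natl.
    have := ler_wpM2r (sqr_ge0 (e / q%:R)) (card_primitive_pair (R:=R) q0).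
    apply: le_trans; rewrite le_eqVlt; apply/orP; left; apply/eqP.
    by field; rewrite gt_eqF.
  rewrite -[leLHS]mulr_natl.
  have : (#|primitive_pairs q| <= q ^ 2)%N.
    by rewrite (leq_trans (max_card _)) // card_prod card_ord mulnn.
  rewrite -(ler_nat R) natrX => /(ler_wpM2r (sqr_ge0 (e / q%:R)))/le_trans.
  apply; rewrite le_eqVlt; apply/orP; left; apply/eqP.
  by field; rewrite gt_eqF.
- by move=> p; apply: measurableX; exact: measurable_frac_itv.
- move=> p _; transitivity (mu (frac_itv e p.1) * mu (frac_itv e p.2))%E.
    by apply: product_measure1E; exact: measurable_frac_itv.
  by rewrite !lebesgue_frac_itv // -EFinM expr2.
- apply/trivIsetP => -[a b] [a' b'] _ _ ne; apply/eqP.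
  apply/negPn/negP => /set0P[[x y] [[/= xa yb] [/= xa' yb']]].
  by move: ne; rewrite (frac_itv_inj e1 xa xa') (frac_itv_inj e1 yb yb') eqxx.
Qed.

(* Two primitive fractions with distinct denominators are distinct, so the sets
   are disjoint unless the overlap bound for [frac_set] applies. *)
Lemma lebesgue_prim_setI e e' q r : (0 < q)%N -> (0 < r)%N -> q != r ->
    0 <= e -> 0 <= e' ->
  (mu2 (prim_set e q `&` prim_set e' r) <= (9 * (e ^+ 2 * e' ^+ 2))%:E)%E.
Proof.
move=> q0 r0 qr e0 e'0.
have [gX|Xg] := leP ((gcdn q r)%:R : R) (Num.max (e * r%:R) (e' * q%:R)).
  have mI : measurable (frac_set e q `&` frac_set e' r).
    by apply: measurableI; exact: measurable_frac_set.
  (* Each coordinate contributes a factor [3 e e'], whence the constant 9. *)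
  apply: (@le_trans _ _ (mu2 ((frac_set e q `&` frac_set e' r) `*`
                              (frac_set e q `&` frac_set e' r)))).
    apply: le_measure; rewrite ?inE.
    - by apply: measurableI; exact: measurable_prim_set.
    - exact: measurableX.
    - move=> [x y] [[p _ [/= xp yp]] [p' _ [/= xp' yp']]].
      by split; split => /=; [exists p.1|exists p'.1|exists p.2|exists p'.2].
  rewrite [leLHS]product_measure1E //.
  have h := lebesgue_frac_setI q0 r0 e0 e'0 gX.
  rewrite (le_trans (lee_pmul _ _ h h)) ?measure_ge0 // -EFinM lee_fin.
  by rewrite le_eqVlt; apply/orP; left; apply/eqP; ring.
rewrite (_ : _ `&` _ = set0) ?measure0 ?lee_fin ?mulr_ge0 ?sqr_ge0 //.
rewrite -subset0 => -[x y] [[p /= pp [/= xp yp]] [p' /= pp' [/= xp' yp']]].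
suff E (a : 'I_q) (b : 'I_r) (z : R) : frac_itv e a z -> frac_itv e' b z ->
    (a * r = b * q)%N.
  have E1 := E _ _ _ xp xp'; have E2 := E _ _ _ yp yp'.
  move/negP: qr; apply; move: pp pp'; rewrite !inE => /eqP pp /eqP pp'.
  (* Both gcds being 1, this equality says [r = q]. *)
  have : (gcdn (gcdn p.1 p.2) q * r = gcdn (gcdn p'.1 p'.2) r * q)%N.
    by rewrite !muln_gcdl E1 E2 [(r * q)%N]mulnC.
  by rewrite pp pp' !mul1n eq_sym => ->.
move=> za zb; have := lt_trans (frac_itv_close za zb) Xg.
set d := gcdn q r.
have d0 : (0 < d)%N by rewrite gcdn_gt0 q0.
(* A multiple of [d] of absolute value below [d] is zero. *)
have : (d%:Z %| (a * r)%N%:Z - (b * q)%N%:Z)%Z.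
  by rewrite rpredB // -?dvdn_intE dvdzE /= dvdn_mull ?dvdn_gcdl ?dvdn_gcdr.
move=> /dvdzP[k kE].
have -> : a%:R * r%:R - b%:R * q%:R = (k * d%:Z)%:~R :> R.
  by rewrite -kE intrB -!pmulrn !natrM.
rewrite intrM normrM -pmulrn normr_nat gtr_pMl ?ltr0n // -intr_norm.
rewrite -[1]/(1%:~R) ltr_int => k1.
have k0 : k = 0 by lia.
by move: kE; rewrite k0 mul0r; lia.
Qed.

End rational_boxes.

(** * Lower bound for the measure of a union of quasi-independent sets *)

Section second_moment.
Context {R : realType}.
Local Notation T := (measurableTypeR R).
Local Notation mu := (@lebesgue_measure R).
Local Notation mu2 := (mu \x mu)%E.
Implicit Types (e : nat -> R).

Let U e N t := \big[setU/set0]_(N <= q < t) prim_set (e q) q.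

Let mU e N t : measurable (U e N t).
Proof. by apply: bigsetU_measurable => q _; exact: measurable_prim_set. Qed.

(** The index [t'] of the single set is kept apart from [t], so that it stays fixed in the induction
    on [t]. *)
Let overlap e N t (t' : nat) : (0 < N)%N -> (t <= t')%N -> (N <= t')%N ->
    (forall q, 0 <= e q) ->
  (mu2 (U e N t `&` prim_set (e t') t') <=
    (9 * (\sum_(N <= q < t) e q ^+ 2) * e t' ^+ 2)%:E)%E.
Proof.
move=> N0 + Nt' e0; have t'0 : (0 < t')%N by apply: leq_trans Nt'.
elim: t => [|t IH] tt'.
  by rewrite /U !big_geq // set0I measure0 mulr0 mul0r.
have [tN|Nt] := ltnP t N.
  by rewrite /U !big_geq // set0I measure0 mulr0 mul0r.
rewrite /U !big_nat_recr //= setIUl mulrDr mulrDl EFinD.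
apply: (le_trans (measureU2 _ _ _)).
- by apply: measurableI; [exact: mU|exact: measurable_prim_set].
- by apply: measurableI; exact: measurable_prim_set.
apply: leeD; first by apply: IH; exact: ltnW.
rewrite -mulrA; apply: lebesgue_prim_setI => //; first exact: leq_trans Nt.
by rewrite ltn_eqF.
Qed.

(** With [x = e t ^ 2] and [s] the earlier sum, a new set has measure at least [x / 4] and meets the
    union in at most [9 s x], a loss covered by the growth of [9 / 2 * s ^ 2]. *)
Let union_lower e N t : (0 < N)%N -> (forall q, 0 <= e q <= 1) ->
  exists2 v : R, mu2 (U e N t) = v%:E &
    (\sum_(N <= q < t) e q ^+ 2) / 4 - 9 / 2 * (\sum_(N <= q < t) e q ^+ 2) ^+ 2
      <= v.
Proof.
move=> N0 e01; have e0 q : 0 <= e q by have /andP[] := e01 q.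
elim: t => [|t [v vE vS]].
  by rewrite /U !big_geq //; exists 0; rewrite ?measure0 //; lra.
have [tN|Nt] := ltnP t N.
  by rewrite /U !big_geq //; exists 0; rewrite ?measure0 //; lra.
have /andP[a1 a2] := lebesgue_prim_set (leq_trans N0 Nt) (e01 t).
have o := overlap N0 (leqnn t) Nt e0.
have mA := measurable_prim_set (e t) t.
have [a aE] : exists a, mu2 (prim_set (e t) t) = a%:E.
  exists (fine (mu2 (prim_set (e t) t))); rewrite fineK // ge0_fin_numE //.
  by rewrite (le_lt_trans a2) // ltry.
have [b bE] : exists b, mu2 (U e N t `&` prim_set (e t) t) = b%:E.
  exists (fine (mu2 (U e N t `&` prim_set (e t) t))).
  by rewrite fineK // ge0_fin_numE // (le_lt_trans o) // ltry.
exists (v + a - b).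
  rewrite /U big_nat_recr //= measureUfinr //; last by rewrite [ltLHS]aE ltry.
  - by rewrite [X in (X + _ - _)%E]vE [X in (_ + X - _)%E]aE [X in (_ - X)%E]bE.
  - exact: mU.
move: a1 o; rewrite aE bE !lee_fin big_nat_recr //= => a1 o.
move: vS o; set s := \sum_(_ <= _ < _) _; move: a1; set x := e t ^+ 2.
have : 0 <= x ^+ 2 by rewrite sqr_ge0.
by rewrite !expr2; nra.
Qed.

(* Bonferroni's inequality, for the first partial sum exceeding [1 / 72]. *)
Lemma lebesgue_bigcup_prim_set e N t : (0 < N)%N ->
    (forall q, 0 <= e q <= 1 / 9) ->
    1 / 72 <= \sum_(N <= q < t) e q ^+ 2 ->
  ((1 / 576)%:E <= mu2 (\bigcup_(q in [set q | (N <= q)%N]) prim_set (e q) q))%E.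
Proof.
move=> N0 e9 St.
have e1 q : 0 <= e q <= 1.
  by have /andP[-> /= h] := e9 q; apply: le_trans h _; lra.
have [s Ss smin] := ex_minnP (ex_intro (fun t =>
   1 / 72 <= \sum_(N <= q < t) e q ^+ 2) t St).
(* By minimality the sum without its last term is below 1/72, and that term is at most 1/81. *)
have S2 : \sum_(N <= q < s) e q ^+ 2 <= 1 / 36.
  case: s Ss smin => [|s] Ss smin; first by rewrite big_geq //; lra.
  have [sN|Ns] := ltnP s N; first by rewrite big_geq //; lra.
  have : ~~ (1 / 72 <= \sum_(N <= q < s) e q ^+ 2).
    by apply/negP => /smin; rewrite ltnn.
  rewrite -ltNge big_nat_recr //=; have /andP[h1 h2] := e9 s.
  have : e s ^+ 2 <= (1 / 9) ^+ 2 by rewrite lerXn2r ?nnegrE //; lra.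
  by move: (\sum_(_ <= _ < _) _) => x; lra.
have [v vE vS] := union_lower s N0 e1.
(* For a sum [S] in [[1/72, 1/36]], [S (1/4 - 9/2 S) >= 1/72 * 1/8 = 1/576]. *)
apply: (@le_trans _ _ (mu2 (U e N s))).
  rewrite vE lee_fin; apply: le_trans vS; move: Ss S2.
  by move: (\sum_(_ <= _ < _) _) => x x1 x2; nra.
apply: le_measure; rewrite ?inE; first exact: mU.
  by apply: bigcup_measurable => q _; exact: measurable_prim_set.
rewrite /U -bigcup_seq => z [q /=]; rewrite mem_index_iota => /andP[Nq _] zq.
by exists q.
Qed.

End second_moment.

(** * Zero-one laws on the line and in the plane *)

Section zero_one.
Context {R : realType}.
Local Notation T := (measurableTypeR R).
Local Notation mu := (@lebesgue_measure R).
Local Notation mu2 := (mu \x mu)%E.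

(** The right-hand side is a measure in [A] that agrees with [mu] on the intervals []a, b]], which
    determine [mu]. *)
Lemma lebesgue_measure_affine (k p : R) (A : set T) : 0 < k -> measurable A ->
  mu A = (k%:E * mu ((fun y => k * y - p)%R @^-1` A))%E.
Proof.
move=> k0 mA; pose f (y : T) : T := (k * y - p)%R.
have mf : measurable_fun [set: T] f.
  by apply: measurable_funB => //; exact: measurable_funM.
pose nu := mscale (NngNum (ltW k0)) (pushforward mu f).
have -> : (k%:E * mu ((fun y => k * y - p)%R @^-1` A))%E = nu mf A by [].
apply: lebesgue_measure_unique => // _ [[a b]] _ <-.
change (mu `]a, b]%classic = (k%:E * mu (f @^-1` `]a, b]%classic))%E).
have -> : f @^-1` `]a, b] = `](a + p) / k, (b + p) / k]%classic.
  apply/seteqP; split => y; rewrite /= !in_itv /= /f ltr_pdivrMr // ler_pdivlMr //.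
    by rewrite (mulrC y) => /andP[? ?]; apply/andP; split; lra.
  by rewrite (mulrC y) => /andP[? ?]; apply/andP; split; lra.
rewrite !lebesgue_measure_itv /= !lte_fin ltr_pM2r ?invr_gt0 // ltrD2r.
case: ifP => _; last by rewrite mule0.
by rewrite -!EFinB -EFinM; congr EFin; field; rewrite gt_eqF.
Qed.

(* Every interval [[p / k, (p + 1) / k)] contains a copy of [F] in [[0, 1)]
   scaled by [1 / k], where [F] is the complement of [E]. If [F] is not null, it
   thus has positive lower density everywhere, so by Lebesgue's density theorem
   almost no point lies in [E]. *)
Lemma zero_one (E : set T) : measurable E ->
    (forall (z : int) x, E x -> E (x + z%:~R)) ->
    (forall (k : nat) x, (0 < k)%N -> E x -> E (k%:R * x)) ->
  mu E = 0%E \/ mu (~` E) = 0%E.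
Proof.
move=> mE ED EM; set F := ~` E.
have mF : measurable F by exact: measurableC.
have FD (z : int) x : F (x + z%:~R) -> F x.
  by move=> nE /(ED z).
have FM (k : nat) x : (0 < k)%N -> F (k%:R * x) -> F x.
  by move=> k0 nE /(EM k _ k0).
pose F0 : set T := F `&` `[0, 1[%classic.
have mF0 : measurable F0 by exact: measurableI.
have F01 : (mu F0 <= 1%:E)%E.
  apply: (@le_trans _ _ (mu `[0%R, 1%R[%classic)); first exact: measureIr.
  by rewrite lebesgue_measure_itv /= lte_fin ltr01 oppr0 adde0.
have [c c0 cE] : exists2 c : R, 0 <= c & mu F0 = c%:E.
  exists (fine (mu F0)); first by rewrite fine_ge0.
  by rewrite fineK // ge0_fin_numE // (le_lt_trans F01) // ltry.
have mpre (k p : R) : measurable ((fun y : T => (k * y - p)%R : T) @^-1` F0).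
  rewrite -[X in measurable X]setTI.
  by apply: measurable_funB => //; exact: measurable_funM.
move: c0; rewrite le_eqVlt => /predU1P[c0|c0].
  right; apply/eqP; rewrite -measure_le0.
  (* The translates of [F0] by [k] and by [-(k + 1)], matching the two constructors of [int];
     together they cover [F]. *)
  pose G (k : nat) : set T := ((fun y : T => (1 * y - k%:R)%R : T) @^-1` F0) `|`
                 ((fun y : T => (1 * y - (- k.+1%:R))%R : T) @^-1` F0).
  have mG k : measurable (G k) by apply: measurableU; exact: mpre.
  have G0 k : mu (G k) = 0%E.
    apply: null_set_setU; try exact: mpre.
      by have := lebesgue_measure_affine k%:R ltr01 mF0;
        rewrite mul1e cE -c0; exact: esym.
    by have := lebesgue_measure_affine (- k.+1%:R) ltr01 mF0;
        rewrite mul1e cE -c0; exact: esym.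
  have FG : F `<=` \bigcup_k G k.
    move=> x Fx; have := Num.Theory.floor_itv x.
    have H (z : int) : z%:~R <= x < (z + 1)%:~R -> F0 (1 * x - z%:~R).
      rewrite intrD => /andP[z1 z2]; split.
        apply: (FD z); rewrite mul1r subrK; exact: Fx.
      by rewrite /= in_itv /= mul1r; apply/andP; split; lra.
    by case: (Num.floor x) => k /H h; exists k => //; [left|right].
  rewrite (le_trans (measure_sigma_subadditive mu mG mF FG)) //.
  by rewrite eseries0 // => k _ _; exact: G0.
left; have := lebesgue_density mF => /negligibleS h.
apply/(negligibleP _ mE)/h => x Ex /=.
rewrite indicE memNset; last by move=> /(_ Ex).
(* If the density of [F] at [x] were 0, small balls would have ratio below [c / 8]. But the ball of
   radius [2 / k], of measure [4 / k], contains a part of [F] of measure [c / k], a ratio of at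
   least [c / 4]. *)
move=> /(_ _ (@open_ereal_lt' _ 0%E (c / 8)%:E _)); rewrite lte_fin divr_gt0 //.
move=> /(_ isT) [e /= e0 he].
pose k := (Num.truncn (2 / e)).+1.
have k0 : 0 < k%:R :> R by rewrite ltr0n.
have ke : 2 / k%:R < e.
  by rewrite ltr_pdivrMr // mulrC -ltr_pdivrMr // truncnS_gt.
have /he : ball (0 : R) e (2 / k%:R).
  by rewrite /ball /= sub0r normrN gtr0_norm // divr_gt0.
rewrite divr_gt0 // => /(_ isT); rewrite lebesgue_measure_ball ?divr_ge0 //.
rewrite inver mulrn_eq0 /= mulf_eq0 invr_eq0 !pnatr_eq0 /=.
apply/negP; rewrite -leNgt.
pose p := Num.floor (k%:R * x).
have sub : (fun y : T => (k%:R * y - p%:~R)%R : T) @^-1` F0 `<=`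
    F `&` ball (x : R) (2 / k%:R).
  move=> y [Fy]; rewrite /= in_itv /= => /andP[y0 y1]; split.
    apply: (FM k) => //; apply: (FD (- p)); rewrite intrN; exact: Fy.
  have /andP[] := Num.Theory.floor_itv (k%:R * x); rewrite -/p intrD => p0 p1.
  rewrite /ball /= -(ltr_pM2l k0) mulrCA divff ?gt_eqF // mulr1.
  by rewrite -[X in X * `|_|](gtr0_norm k0) -normrM mulrBr ltr_norml; lra.
have cF : ((c / k%:R)%:E <= mu (F `&` ball (x : R) (2 / k%:R)))%E.
  apply: (@le_trans _ _ (mu ((fun y : T => (k%:R * y - p%:~R)%R : T) @^-1` F0))).
    have := lebesgue_measure_affine p%:~R k0 mF0; rewrite cE => cE'.
    by rewrite mulrC EFinM cE' muleA -EFinM mulVf ?gt_eqF // mul1e.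
  apply: le_measure => //; rewrite inE; first exact: mpre.
  by apply: measurableI => //; exact: measurable_ball.
apply: (le_trans _ (lee_wpmul2r _ cF)); last first.
  by rewrite lee_fin invr_ge0 mulrn_wge0 // divr_ge0.
rewrite -EFinM lee_fin (_ : c / k%:R / (2 / k%:R *+ 2) = c / 4); first by lra.
by rewrite mulr2n; field; rewrite gt_eqF.
Qed.

(** The product measure is the integral of the nonnegative section measure, which vanishes exactly
    when the integrand does almost everywhere. *)
Lemma product_measure_eq0 (A : set (T * T)) : measurable A ->
  mu2 A = 0%E <-> mu.-negligible [set x | mu (xsection A x) <> 0%E].
Proof.
move=> mA; have mphi := measurable_fun_xsection mu mA.
have := ae_eq_integral_abs mu measurableT mphi.
rewrite (eq_integral (mu \o xsection A)) => [[h1 h2]|x _]; last first.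
  by rewrite gee0_abs.
split=> [/h1|h].
  by apply: negligibleS => x /= nz; apply/not_implyP; split.
by apply: h2; move: h; apply: negligibleS => x /= /not_implyP[_].
Qed.

(* The one-dimensional law is applied to the sections of [E] and then to the
   set of abscissas whose section is conull. *)
Lemma zero_one_prod (E : set (T * T)) : measurable E ->
    (forall (z : int) x y, E (x, y) -> E (x + z%:~R, y)) ->
    (forall (k : nat) x y, (0 < k)%N -> E (x, y) -> E (k%:R * x, y)) ->
    (forall (z : int) x y, E (x, y) -> E (x, y + z%:~R)) ->
    (forall (k : nat) x y, (0 < k)%N -> E (x, y) -> E (x, k%:R * y)) ->
  mu2 E <> 0%E -> mu2 (~` E) = 0%E.
Proof.
move=> mE D1 M1 D2 M2 nE; have mCE := measurableC mE.
have mphi := measurable_fun_xsection mu mCE.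
pose X : set T := [set x | mu (xsection (~` E) x) = 0%E].
have mX : measurable X.
  by rewrite -[X in measurable X]setTI; exact: (mphi _ [set 0%E]).
have XS x x' : (forall y, E (x, y) -> E (x', y)) -> X x -> X x'.
  move=> xx' /eqP; rewrite -measure_le0 => Xx.
  apply/eqP; rewrite -measure_le0; apply: le_trans Xx.
  apply: le_measure; rewrite ?inE; try exact: measurable_xsection.
  by move=> y; rewrite !xsectionE /= => nE' /xx'.
have [X0|X0] := zero_one mX (fun z x => XS _ _ (D1 z x))
  (fun k x k0 => XS _ _ (fun y => M1 k x y k0)); last first.
  by apply/product_measure_eq0 => //; exact/(negligibleP _ (measurableC mX)).
(* If [X] is null, almost no section is conull, so almost every section is null by the
   one-dimensional law. *)
exfalso; apply/nE/product_measure_eq0 => //.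
have := (negligibleP mu mX).2 X0; apply: negligibleS => x /= nx.
have hD (z : int) y : xsection E x y -> xsection E x (y + z%:~R).
  by rewrite !xsectionE /=; exact: D2.
have hM (k : nat) y : (0 < k)%N -> xsection E x y -> xsection E x (k%:R * y).
  by rewrite !xsectionE /=; exact: M2.
have [//|] := zero_one (measurable_xsection x mE) hD hM.
by rewrite /X /= !xsectionE.
Qed.

End zero_one.

(** * Approximation with two varying coordinates *)

Section planar.
Context {R : realType}.
Local Notation T := (measurableTypeR R).
Local Notation mu := (@lebesgue_measure R).
Local Notation mu2 := (mu \x mu)%E.
Implicit Types (f : nat -> R) (al s : seq R).

(** Points are sequences read through membership only, so that varying and fixed coordinates can be
    concatenated and permuted. *)
Definition near_ints (c : R) (q : nat) s :=
  forall r, r \in s -> near_int c (q%:R * r).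

(* Compared with [f]-approximability, the factor [p.+1^-1] makes
   [well_approximable] stable under multiplication of a coordinate by a
   positive integer. *)
Definition approximable_at f p s :=
  exists2 q, (p < q)%N & near_ints (f q / p.+1%:R) q s.

Definition well_approximable f s := forall p, approximable_at f p s.

Lemma near_ints_cons c q (r : R) s :
  near_ints c q (r :: s) <-> near_int c (q%:R * r) /\ near_ints c q s.
Proof.
split=> [h|[h1 h2] r']; last by rewrite inE => /predU1P[->|/h2].
by split=> [|r' r's]; apply: h; rewrite inE ?eqxx // r's orbT.
Qed.

Lemma near_intsW c c' q s : c <= c' -> near_ints c q s -> near_ints c' q s.
Proof. by move=> cc' h r /h; exact: near_intW. Qed.

Lemma well_approximable_eq f s s' : s =i s' ->
  well_approximable f s -> well_approximable f s'.
Proof.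
by move=> ss' h p; have [q pq hq] := h p; exists q => // r; rewrite -ss'; exact: hq.
Qed.

Lemma well_approximableD f (z : int) (r : R) s :
  well_approximable f (r :: s) -> well_approximable f (r + z%:~R :: s).
Proof.
move=> h p; have [q pq /near_ints_cons[h1 h2]] := h p; exists q => //.
apply/near_ints_cons; split=> //; rewrite mulrDr.
have -> : q%:R * z%:~R = (q%:Z * z)%:~R :> R by rewrite intrM -pmulrn.
exact: near_intD.
Qed.

Lemma well_approximableM f (k : nat) (r : R) s : (0 < k)%N ->
    (forall q, (0 < q)%N -> 0 <= f q) ->
  well_approximable f (r :: s) -> well_approximable f (k%:R * r :: s).
Proof.
(* At this level the bound is [f q / (k (p + 1))]; multiplication by [k] brings it back to
   [f q / (p + 1)]. *)
move=> k0 f0 h p; have [q pq] := h (k * p.+1).-1.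
rewrite prednK ?muln_gt0 ?k0 // natrM => /near_ints_cons[h1 h2].
have q0 : (0 < q)%N by apply: leq_ltn_trans pq.
have k0' : 0 < k%:R :> R by rewrite ltr0n.
have E : k%:R * (f q / (k%:R * p.+1%:R)) = f q / p.+1%:R.
  by field; rewrite !gt_eqF // ltr0n.
exists q.
  by rewrite (leq_ltn_trans _ pq) // -ltnS prednK ?muln_gt0 ?k0 // leq_pmull.
apply/near_ints_cons; split.
  by rewrite mulrCA -E; exact: near_int_natM.
apply: near_intsW h2; rewrite -E ler_peMl ?ler1n // divr_ge0 ?f0 // mulr_ge0.
Qed.

Lemma measurable_near_int (c : R) (q : nat) :
  measurable [set r : T | near_int c (q%:R * r)].
Proof.
rewrite (_ : [set r | _] =
    \bigcup_(z in [set: int]) [set r : T | `|q%:R * r - z%:~R| < c]).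
  apply: countable_bigcupT_measurable; first exact: countableP.
  move=> z; rewrite (_ : [set r | _] =
    (fun r : T => (q%:R * r - z%:~R : T)%R) @^-1` `](- c)%R, c[%classic).
    rewrite -[X in measurable X]setTI.
    by apply: measurable_funB => //; exact: measurable_funM.
  by apply/seteqP; split => r /=; rewrite in_itv /= ltr_norml.
by apply/seteqP; split => r [z]; exists z.
Qed.

(** Varying coordinates enter through maps [g i], which serves pairs and tuples alike; [al] only
    selects the [q] of a countable union. *)
Lemma measurable_approximable_at d (X : measurableType d) (n : nat)
    (g : 'I_n -> X -> T) f al p : (forall i, measurable_fun setT (g i)) ->
  measurable [set x | approximable_at f p ([seq g i x | i : 'I_n] ++ al)].
Proof.
move=> mg.
rewrite (_ : [set x | _] = \bigcup_(q in [set q | (p < q)%N /\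
    near_ints (f q / p.+1%:R) q al]) \bigcap_(i in [set: 'I_n])
      (g i @^-1` [set r : T | near_int (f q / p.+1%:R) (q%:R * r)])).
  apply: bigcup_measurable => q _.
  apply: fin_bigcap_measurable; first exact: finite_finset.
  move=> i _; rewrite -[X in measurable X]setTI.
  by apply: mg => //; exact: measurable_near_int.
apply/seteqP; split => x /=.
  move=> [q pq hq]; exists q.
    by split=> // r ral; apply: hq; rewrite mem_cat ral orbT.
  by move=> i _; apply: hq; rewrite mem_cat map_f // mem_enum.
move=> [q [pq hal] hg]; exists q => // r.
by rewrite mem_cat => /orP[/mapP[i _ ->]|/hal //]; exact: hg.
Qed.

Lemma measurable_well_approximable d (X : measurableType d) (n : nat)
    (g : 'I_n -> X -> T) f al : (forall i, measurable_fun setT (g i)) ->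
  measurable [set x | well_approximable f ([seq g i x | i : 'I_n] ++ al)].
Proof.
move=> mg; rewrite (_ : [set x | _] = \bigcap_p
    [set x | approximable_at f p ([seq g i x | i : 'I_n] ++ al)]).
  by apply: bigcapT_measurable => p; exact: measurable_approximable_at.
by apply/seteqP; split => x /= h p; [move=> _|]; exact: h.
Qed.

(** Either [f] drops below [c] and the cap changes only finitely many terms, or every capped term is
    [c ^ n]. *)
Lemma diverges_minr f (n : nat) (c : R) : 0 < c ->
    (forall q, (0 < q)%N -> 0 < f q) ->
    (forall q q', (0 < q)%N -> (q <= q')%N -> f q' <= f q) ->
    (forall M : R, exists t : nat, M <= \sum_(1 <= q < t) f q ^+ n) ->
  forall M : R, exists t : nat, M <= \sum_(1 <= q < t) Num.min (f q) c ^+ n.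
Proof.
move=> c0 f0 fS fdiv M.
have m0 q : (0 < q)%N -> 0 < Num.min (f q) c by move=> /f0 fq; rewrite lt_min fq.
have [[q0 q00 fc]|nex] := pselect (exists2 q, (0 < q)%N & f q < c).
  have [t Mt] := fdiv (M + \sum_(1 <= q < q0) f q ^+ n); exists t.
  have [tq|qt] := leqP t q0.
    have : \sum_(1 <= q < t) f q ^+ n <= \sum_(1 <= q < q0) f q ^+ n.
      have [t1|t1] := leqP t 1.
        rewrite big_geq // big_nat; apply: sumr_ge0 => q /andP[q1 _].
        by rewrite exprn_ge0 // ltW // f0.
      rewrite [leRHS](big_cat_nat (n := t)) //=; last exact: ltnW.
      rewrite lerDl big_nat; apply: sumr_ge0 => q /andP[q1 _].
      by rewrite exprn_ge0 // ltW // f0 // (leq_trans _ q1) // ltnW.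
    move=> h; have M0 : M <= 0 by lra.
    apply: le_trans M0 _; rewrite big_nat; apply: sumr_ge0 => q /andP[q1 _].
    by rewrite exprn_ge0 // ltW // m0.
  move: Mt; rewrite !(big_cat_nat (m := 1) (n := q0) (p := t)) //=; try exact: ltnW.
  move=> Mt; have : \sum_(q0 <= q < t) f q ^+ n = \sum_(q0 <= q < t) Num.min (f q) c ^+ n.
    apply: eq_big_nat => q /andP[q1 _]; rewrite min_l //.
    by rewrite ltW // (le_lt_trans _ fc) // fS.
  have : 0 <= \sum_(1 <= q < q0) Num.min (f q) c ^+ n.
    rewrite big_nat; apply: sumr_ge0 => q /andP[q1 _].
    by rewrite exprn_ge0 // ltW // m0.
  lra.
pose k := Num.truncn (M / c ^+ n); exists k.+2.
have -> : \sum_(1 <= q < k.+2) Num.min (f q) c ^+ n = \sum_(1 <= q < k.+2) c ^+ n.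
  apply: eq_big_nat => q /andP[q1 _]; rewrite min_r // leNgt; apply/negP => fq.
  by apply: nex; exists q.
rewrite sumr_const_nat subSS subn0 -[leRHS]mulr_natl -ler_pdivrMr ?exprn_gt0 //.
exact/ltW/truncnS_gt.
Qed.

(* Pigeonhole gives [t <= M ^ l * #{q < t : |q al| < 1 / M}]; it is used with
   [1 / M] between [h t / 2] and [h t]. *)
Lemma good_count (h : nat -> R) al (t : nat) :
    (forall q, (0 < q)%N -> 0 < h q <= 1) ->
    (forall q q', (0 < q)%N -> (q <= q')%N -> h q' <= h q) -> (0 < t)%N ->
  2^-1 ^+ size al * t%:R * h t ^+ size al <=
    1 + \sum_(1 <= q < t) `[< near_ints (h q) q al >]%:R.
Proof.
move=> h01 hS t0; have /andP[ht0 ht1] := h01 t t0.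
pose M := (Num.truncn (h t)^-1).+1.
have M0 : (0 < M)%N by [].
have M0' : 0 < M%:R :> R by rewrite ltr0n.
have Mh : M%:R^-1 <= h t.
  by rewrite -[leRHS]invrK lef_pV2 ?posrE ?invr_gt0 // ltW // truncnS_gt.
(* [M <= 1 / h t + 1 <= 2 / h t], because [h t <= 1]. *)
have hM : 2^-1 * M%:R * h t <= 1.
  have : (Num.truncn (h t)^-1)%:R <= (h t)^-1 by rewrite truncn_le invr_ge0 ltW.
  rewrite -(ler_pM2r ht0) mulVf ?gt_eqF // /M -(natr1 (Num.truncn _)); lra.
(* The term [q = 0] is split off and accounts for the summand 1 of the conclusion. *)
have := near_int_count al t M0; rewrite big_ltn // -(ler_nat R) natrM natrD natr_sum.
set S' := \sum_(_ <= _ < _) `[< near_ints _ _ _ >]%:R.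
set S := \sum_(_ <= _ < _) _ => tS.
have SS : S <= S'.
  rewrite /S /S' !big_nat; apply: ler_sum => q /andP[q1 qt]; rewrite ler_nat.
  case: (asboolP (near_ints (h q) q al)) => hq; first exact: leq_b1.
  case: asboolP => // hn; exfalso; apply: hq => r /hn.
  by apply: near_intW; rewrite (le_trans Mh) // hS // ltnW.
have S0 : 0 <= S' by apply: sumr_ge0 => q _; exact: ler0n.
rewrite -mulrA mulrCA -exprMn mulrC.
have a0 : 0 <= (2^-1 * h t) ^+ size al by rewrite exprn_ge0 // mulr_ge0 ?invr_ge0 // ltW.
apply: (@le_trans _ _ ((2^-1 * h t) ^+ size al * (M%:R ^+ size al * (1 + S')))).
  rewrite ler_wpM2l // (le_trans tS) // natrX ler_wpM2l ?exprn_ge0 ?ler0n //.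
  by rewrite lerD // lern1; case: asboolP.
rewrite mulrA -exprMn mulrAC ler_piMl ?addr_ge0 // exprn_ile1 //.
by rewrite !mulr_ge0 ?invr_ge0 // ltW.
Qed.

(** The bound [c <= 1] keeps the last interval inside [[0, 1)]. The conclusion [0 < c] serves to
    discard the [q] at which the width is set to 0. *)
Lemma prim_set_near_int (c : R) (q : nat) (z : T * T) : c <= 1 ->
  prim_set c q z -> [/\ `[0, 1[%classic z.1, `[0, 1[%classic z.2,
    near_int c (q%:R * z.1), near_int c (q%:R * z.2) & 0 < c].
Proof.
move=> c1 [p _ [/frac_itvP/andP[x1 x2] /frac_itvP/andP[y1 y2]]].
have q0 : (0 < q)%N by apply: leq_ltn_trans (ltn_ord p.1).
have q0' : 0 < q%:R :> R by rewrite ltr0n.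
have H (a : 'I_q) (x : R) : a%:R <= q%:R * x -> q%:R * x < a%:R + c ->
    `[0, 1[%classic x /\ near_int c (q%:R * x).
  move=> h1 h2; split; last by exists a%:Z; rewrite -pmulrn ltr_norml; lra.
  have aq : a%:R + 1 <= q%:R :> R by rewrite natr1 ler_nat.
  rewrite /= in_itv /= -(pmulr_rge0 _ q0') (le_trans _ h1) //=.
  by rewrite -(ltr_pM2l q0') mulr1; lra.
have [] := H p.1 z.1 x1 x2; have [] := H p.2 z.2 y1 y2.
by split => //; lra.
Qed.

Let square : set (T * T) := `[0, 1[%classic `*` `[0, 1[%classic.

Let level f al p : set (T * T) :=
  [set z | approximable_at f p [:: z.1, z.2 & al]].

Let measurable_level f al p : measurable (level f al p).
Proof.
pose g (i : 'I_2) (z : T * T) : T := if i == ord0 then z.1 else z.2.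
have := @measurable_approximable_at _ (T * T)%type _ g f al p _.
rewrite (_ : [set z | _] = level f al p).
  apply => i; rewrite /g; case: eqP => _; first exact: measurable_fst.
  exact: measurable_snd.
by apply/seteqP; split => z; rewrite /level /= /image_mem !enum_ordSl enum_ord0.
Qed.

Let level_lower f al p :
    (forall q, (0 < q)%N -> 0 < f q) ->
    (forall q q', (0 < q)%N -> (q <= q')%N -> f q' <= f q) ->
    (forall M : R, exists t : nat,
      M <= \sum_(1 <= q < t) f q ^+ (size al).+2) ->
  ((1 / 576)%:E <= mu2 (level f al p `&` square))%E.
Proof.
move=> f0 fS fdiv.
have p0 : 0 < p.+1%:R :> R by rewrite ltr0n.
have p1 : p.+1%:R^-1 <= 1 :> R by rewrite invf_le1 // ler1n.
pose h q := Num.min (f q) (1 / 9) / p.+1%:R.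
have h9 q : (0 < q)%N -> 0 < h q <= 1 / 9.
  move=> q0; have m0 : 0 < Num.min (f q) (1 / 9) by rewrite lt_min f0 //=; lra.
  rewrite /h divr_gt0 //= (le_trans (y := Num.min (f q) (1 / 9))) //.
    by rewrite ler_piMr // ltW.
  by rewrite ge_min lexx orbT.
have h1 q : (0 < q)%N -> 0 < h q <= 1.
  by move=> /h9 /andP[-> hq] /=; apply: le_trans hq _; lra.
have hS q q' : (0 < q)%N -> (q <= q')%N -> h q' <= h q.
  move=> q0 qq'; rewrite ler_wpM2r ?invr_ge0 // le_min !ge_min lexx orbT andbT.
  by rewrite fS.
pose l := size al; pose w q : bool := `[< near_ints (h q) q al >].
(* Width 0 makes the set of a bad [q] empty. *)
pose e q := if (0 < q)%N && w q then h q else 0.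
have e9 q : 0 <= e q <= 1 / 9.
  rewrite /e; case: ifP => [/andP[/h9/andP[? ->] _]|_]; first by rewrite ltW.
  by rewrite lexx; lra.
have [t St] : exists t, 1 / 72 <= \sum_(p.+1 <= q < t) e q ^+ 2.
  pose c : R := 2^-1 ^+ l.
  have c0 : 0 < c by rewrite exprn_gt0 // invr_gt0.
  (* The target 1/72, increased by the discarded terms [q <= p] and the error term of
     [abel_lower]. *)
  pose A : R := 1 / 72 + \sum_(1 <= q < p.+1) e q ^+ 2 + h 1%N ^+ 2.
  have pl0 : 0 < p.+1%:R ^+ l.+2 :> R by rewrite exprn_gt0.
  have c9 : 0 < 1 / 9 :> R by lra.
  (* The power of [p.+1] undoes the division in [h]; [l.+2%:R / c] undoes the constant of
     [abel_lower]. *)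
  have [t At] := diverges_minr c9 f0 fS fdiv (A * l.+2%:R / c * p.+1%:R ^+ l.+2).
  exists t.
  have hsum : A * l.+2%:R / c <= \sum_(1 <= q < t) h q ^+ l.+2.
    rewrite -(ler_pM2r pl0) (le_trans At) // mulr_suml le_eqVlt.
    apply/orP; left; apply/eqP/eq_bigr => q _.
    by rewrite /h exprMn -mulrA -exprMn mulVf ?gt_eqF // expr1n mulr1.
  have e2 (s : nat) : \sum_(1 <= q < s) e q ^+ 2 = \sum_(1 <= q < s) (w q)%:R * h q ^+ 2.
    apply: eq_big_nat => q /andP[q0 _]; rewrite /e q0 /=.
    by case: (w q); rewrite ?mul1r // mul0r expr0n.
  have A0 : 0 < A.
    have : 0 <= \sum_(1 <= q < p.+1) e q ^+ 2.
      by apply: sumr_ge0 => q _; rewrite sqr_ge0.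
    have := sqr_ge0 (h 1%N); rewrite /A.
    by move: (\sum_(_ <= _ < _) _) (h 1%N ^+ 2) => x y; lra.
  have t1 : (1 < t)%N.
    rewrite ltnNge; apply/negP => t1; move: At; rewrite big_geq // leNgt.
    by rewrite mulr_gt0 // divr_gt0 // mulr_gt0 ?ltr0n.
  have w0 q : 0 <= (w q)%:R :> R by exact: ler0n.
  have h0 q : (0 < q)%N -> 0 <= h q by move=> /h1/andP[/ltW].
  have hS1 q : (0 < q)%N -> h q.+1 <= h q by move=> q0; exact: hS.
  have hN (s : nat) : (0 < s)%N -> c * s%:R * h s ^+ l <= 1 + \sum_(1 <= q < s) (w q)%:R.
    by move=> s0; exact: good_count.
  have := abel_lower (ltW c0) w0 h0 hS1 hN (ltnW t1).
  rewrite -e2 => ab.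
  have : A <= \sum_(1 <= q < t) e q ^+ 2 + h 1%N ^+ 2.
    apply: le_trans ab; rewrite mulrC mulrA ler_pdivlMr ?ltr0n //.
    by rewrite -ler_pdivrMr.
  rewrite /A; have [tp|pt] := leqP t p.+1.
    rewrite [in X in _ + X + _](big_cat_nat (n := t)) //=; last exact: ltnW.
    have : 0 <= \sum_(t <= q < p.+1) e q ^+ 2.
      by apply: sumr_ge0 => q _; rewrite sqr_ge0.
    by move: (\sum_(t <= _ < _) _) (\sum_(1 <= _ < t) _) (h 1%N ^+ 2) => x y z; lra.
  rewrite (big_cat_nat (m := 1) (n := p.+1) (p := t)) //=; last exact: ltnW.
  by move: (\sum_(1 <= _ < p.+1) _) (\sum_(p.+1 <= _ < t) _) (h 1%N ^+ 2) => x y z; lra.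
apply: (le_trans (lebesgue_bigcup_prim_set (ltn0Sn p) e9 St)).
apply: le_measure; rewrite ?inE.
- by apply: bigcup_measurable => q _; exact: measurable_prim_set.
- apply: measurableI; first exact: measurable_level.
  by apply: measurableX; exact: measurable_itv.
move=> z [q /= pq zq].
have e1 : e q <= 1 by have /andP[_ /le_trans] := e9 q; apply; lra.
have [z1 z2 n1 n2 e0] := prim_set_near_int e1 zq.
split; last by split.
move: e0 n1 n2; rewrite /e; case: ifP => [/andP[q0 /asboolP wq] _ n1 n2|];
  last by rewrite ltxx.
exists q => //; apply/near_ints_cons; split.
  by apply: near_intW n1; rewrite ler_wpM2r ?invr_ge0 // ge_min lexx.
apply/near_ints_cons; split.
  by apply: near_intW n2; rewrite ler_wpM2r ?invr_ge0 // ge_min lexx.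
by apply: near_intsW wq; rewrite ler_wpM2r ?invr_ge0 // ge_min lexx.
Qed.

Lemma well_approximable_ae_plane f al :
    (forall q, (0 < q)%N -> 0 < f q) ->
    (forall q q', (0 < q)%N -> (q <= q')%N -> f q' <= f q) ->
    (forall M : R, exists t : nat,
      M <= \sum_(1 <= q < t) f q ^+ (size al).+2) ->
  mu2 [set z : T * T | ~ well_approximable f [:: z.1, z.2 & al]] = 0%E.
Proof.
move=> f0 fS fdiv.
have f0' q : (0 < q)%N -> 0 <= f q by move=> /f0/ltW.
pose E : set (T * T) := [set z | well_approximable f [:: z.1, z.2 & al]].
have EE : E = \bigcap_p level f al p.
  by apply/seteqP; split => z /= h p; [move=> _|]; exact: h.
have mE : measurable E.
  by rewrite EE; apply: bigcapT_measurable => p; exact: measurable_level.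
have swap (x y : R) : well_approximable f [:: x, y & al] ->
    well_approximable f [:: y, x & al].
  by apply: well_approximable_eq => r; rewrite !inE orbCA.
apply: (@zero_one_prod R E) => //.
- by move=> z x y; exact: well_approximableD.
- by move=> k x y k0; exact: well_approximableM.
- by move=> z x y /swap /(@well_approximableD f z) /swap.
- by move=> k x y k0 /swap /(well_approximableM k0 f0') /swap.
(* If [E] were null, the sets [D p] would decrease, inside a square of finite measure, to a null
   set, against the uniform bound 1/576. *)
move=> E0; pose D p := level f al p `&` square.
have mD p : measurable (D p).
  apply: measurableI; first exact: measurable_level.
  by apply: measurableX; exact: measurable_itv.
have : mu2 (\bigcap_p D p) = 0%E.
  apply: (subset_measure0 (mu := mu2) _ mE _ E0).
    by apply: bigcapT_measurable.
  by rewrite EE => z h p _; have [] := h p I.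
have D0 : (mu2 (D 0%N) < +oo)%E.
  apply: (@le_lt_trans _ _ (mu2 square)).
    apply: le_measure; rewrite ?inE //; last by move=> z [].
    by apply: measurableX; exact: measurable_itv.
  have -> : mu2 square = (mu `[0%R, 1%R[%classic * mu `[0%R, 1%R[%classic)%E.
    by apply: product_measure1E; exact: measurable_itv.
  by rewrite lebesgue_measure_itv /= lte_fin ltr01 oppr0 adde0 mul1e ltry.
have niD : nonincreasing_seq D.
  apply/nonincreasing_seqP => p; apply/subsetPset => z [[q pq hq] zs]; split => //.
  exists q; first exact: ltnW.
  apply: near_intsW hq; rewrite ler_wpM2l ?f0' ?(leq_trans _ pq) //.
  by rewrite lef_pV2 ?posrE ?ltr0n // ler_nat.
have := nonincreasing_cvg_mu D0 mD (bigcapT_measurable mD) niD.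
move=> cD h0; have : ((1 / 576)%:E <= mu2 (\bigcap_p D p))%E.
  by apply: (cvge_ge _ cD); apply: nearW => p; exact: level_lower.
by rewrite h0 lee_fin; lra.
Qed.

End planar.

(** * From the plane to tuples by Fubini *)

Section fibration.
Context {R : realType}.
Local Notation T := (measurableTypeR R).
Local Notation mu := (@lebesgue_measure R).
Local Notation mu2 := (mu \x mu)%E.

Lemma lebesgue_tupleS (n : nat) (A : set (n.+1.-tuple T)) :
  lebesgue_tuple R n.+1 A =
  (\int[mu]_x lebesgue_tuple R n [set t | A (tuple_cons (x, t))])%E.
Proof.
rewrite /= /lebesgue_step /pushforward /product_measure1.
by apply: eq_integral => x _ /=; rewrite xsectionE.
Qed.

Lemma measurable_tuple_cons_section (n : nat) (A : set (n.+1.-tuple T)) (x : T) :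
  measurable A -> measurable [set t : n.-tuple T | A (tuple_cons (x, t))].
Proof.
move=> mA.
rewrite (_ : [set t | _] = xsection (@tuple_cons R n @^-1` A) x); last first.
  by rewrite xsectionE.
apply: measurable_xsection; rewrite -[X in measurable X]setTI.
exact: measurable_tuple_cons.
Qed.

Lemma lebesgue_tuple1 (A : set (1.-tuple T)) : measurable A ->
  lebesgue_tuple R 1 A = mu [set y : T | A [tuple y]].
Proof.
move=> mA; rewrite lebesgue_tupleS.
have consE (y : T) : tuple_cons (y, [tuple]) = [tuple y] by exact/val_inj.
rewrite -[in RHS](setIT [set y | _]) -integral_indic //.
rewrite (_ : [set y | _] = ysection (@tuple_cons R 0 @^-1` A) [tuple]).
  apply: measurable_ysection; rewrite -[X in measurable X]setTI.
  exact: measurable_tuple_cons.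
by apply/seteqP; split => y; rewrite /ysection /= inE /= consE.
Qed.

Lemma lebesgue_tuple2 (A : set (2.-tuple T)) : measurable A ->
  lebesgue_tuple R 2 A = mu2 [set z : T * T | A [tuple z.1; z.2]].
Proof.
move=> mA; rewrite lebesgue_tupleS /product_measure1.
apply: eq_integral => x _ /=; rewrite -[LHS]/(lebesgue_tuple R 1 _) lebesgue_tuple1.
  rewrite xsectionE; congr (mu _); apply/seteqP; split => y /=;
  by rewrite (_ : tuple_cons _ = [tuple x; y]) //; exact/val_inj.
exact: measurable_tuple_cons_section.
Qed.

Lemma measurable_not_well_approximable (m : nat) f (al : seq R) :
  measurable [set t : m.-tuple T | ~ well_approximable f (t ++ al)].
Proof.
have := @measurable_well_approximable R _ (m.-tuple T : measurableType _) m
  (fun i t => tnth t i) f al (fun i => measurable_tnth i).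
move/measurableC; congr (measurable _); apply/seteqP; split => t /=.
all: by rewrite (_ : [seq tnth t i | i : 'I_m] = t) //; exact: map_tnth_enum.
Qed.

(** Fixing the first coordinate [x] moves it into [al], which leaves the exponent unchanged; every
    section is then null by induction, down to the planar case. *)
Lemma well_approximable_ae_tuple (f : nat -> R) (m : nat) (al : seq R) :
    (forall q, (0 < q)%N -> 0 < f q) ->
    (forall q q', (0 < q)%N -> (q <= q')%N -> f q' <= f q) ->
    (forall M : R, exists t : nat,
      M <= \sum_(1 <= q < t) f q ^+ (m.+2 + size al)) ->
  lebesgue_tuple R m.+2 [set t | ~ well_approximable f (t ++ al)] = 0%E.
Proof.
move=> f0 fS; elim: m al => [|m IH] al fdiv.
  rewrite lebesgue_tuple2; last exact: measurable_not_well_approximable.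
  exact: well_approximable_ae_plane.
rewrite lebesgue_tupleS; apply: integral0_eq => x _.
rewrite -[RHS](IH (x :: al)); last by rewrite /= addnS.
congr (lebesgue_tuple _ _ _); apply/seteqP; split => t /= h wa; apply: h.
  by apply: well_approximable_eq wa => r; rewrite /= !(inE, mem_cat) orbCA.
by apply: well_approximable_eq wa => r; rewrite /= !(inE, mem_cat) orbCA.
Qed.

Lemma eseries_pinfty_unbounded (u : nat -> R) (m : nat) :
  (forall q, (m <= q)%N -> 0 <= u q) ->
  (\sum_(m <= q <oo) (u q)%:E = +oo)%E ->
  forall M : R, exists t : nat, M <= \sum_(m <= q < t) u q.
Proof.
move=> u0 uoo M; apply: contrapT => /forallNP h.
suff : (\sum_(m <= q <oo) (u q)%:E <= M%:E)%E by rewrite uoo leye_eq.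
apply: lime_le.
  by apply: is_cvg_nneseries => q mq _; rewrite lee_fin u0.
apply: nearW => t; rewrite sumEFin lee_fin ltW // ltNge; apply/negP; exact: h.
Qed.

Lemma dist_int_lt (n : nat) (x : 'rV[R]_n) (c : R) : 0 < c ->
  (forall i, near_int c (x ord0 i)) -> dist_int x < c.
Proof.
move=> c0 /choice[z zc].
have [w -> wmin] := dist_int_min x.
apply: le_lt_trans (wmin (\row_i z i)) _.
rewrite [ltLHS]mx_normrE; apply/bigmax_ltP; split => // -[i j] _ /=.
by rewrite !mxE (ord1 i); exact: zc.
Qed.

End fibration.

(** * Transport to the subspace through its chart *)

Theorem theorem3p2 (R : realType) (n : nat)
    (V : affine_coordinate_subspace R n) (hV : (2 <= subspace_dim V)%N) :
  khintchine_type_divergence V.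
Proof.
move=> psi [psi0 psiS] psi_div.
pose f (q : nat) : R := psi q%:R.
have f0 q : (0 < q)%N -> 0 < f q by move=> q0; apply: psi0; rewrite ltr0n.
have fS q q' : (0 < q)%N -> (q <= q')%N -> f q' <= f q.
  by move=> q0 qq'; apply: psiS; rewrite ?ltr0n ?ler_nat.
pose al := [seq fixed_value V i | i <- enum (fixed_coords V)].
have nE : n = (subspace_dim V + size al)%N.
  by rewrite size_map -cardE addnC cardsC card_ord.
have fdiv (M : R) : exists t : nat,
    M <= \sum_(1 <= q < t) f q ^+ (subspace_dim V + size al).
  apply: eseries_pinfty_unbounded => [q q0|]; first by rewrite exprn_ge0 // ltW // f0.
  by rewrite -nE.
have null : lebesgue_tuple R (subspace_dim V)
    [set t | ~ well_approximable f (t ++ al)] = 0%E.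
  move: fdiv; rewrite -(subnKC hV) add2n; exact: well_approximable_ae_tuple.
exists [set t : (subspace_dim V).-tuple (measurableTypeR R) |
    ~ well_approximable f (t ++ al)]; split => //.
  exact: measurable_not_well_approximable.
move=> t /= nt wa; apply: nt => fin.
(* Were the solutions [q] finite in number, level [N] of [well_approximable], for [N] their maximum,
   would give a larger one. *)
pose N := \max_(q <- finmap.enum_fset (fset_set [set q : nat | (0 < q)%N /\
  dist_int (q%:R *: subspace_chart t) < psi q%:R])) q.
have [q Nq hq] := wa N.
have q0 : (0 < q)%N by apply: leq_ltn_trans Nq.
have : (q <= N)%N.
  apply: (@leq_bigmax_seq _ _ xpredT id) => //.
  rewrite in_fset_set // inE /=; split => //.
  apply: dist_int_lt => [|i]; first exact: f0.
  rewrite !mxE; apply: (@near_intW _ (f q / N.+1%:R)).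
    by rewrite ler_piMr ?(ltW (f0 _ q0)) // invf_le1 // ler1n.
  apply: hq; rewrite mem_cat; case: ifPn => iF.
    by rewrite map_f ?orbT // mem_enum.
  (* A free index occurs in the enumeration, so the default 0 of [nth] is never reached. *)
  apply/orP; left; apply: mem_nth; rewrite size_tuple /subspace_dim cardE index_mem.
  by rewrite mem_enum inE.
by rewrite leqNgt Nq.
Qed.
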